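(* Fix an integer $k \geq 2$ and let $G$ be a finite simple vertex critical graph with $\chi(G) \geq \Delta(G) + 1 - k$. If $\Delta(G) + 1 \geq 6k$ and $\mathcal{H}(G)$ is edgeless, then $G = K_{\chi(G)}$.
   Context: A graph $G$ is vertex critical if $\chi(G - v) < \chi(G)$ for every vertex $v$. For $r \geq 0$, $G^{\geq r}$ denotes the subgraph of $G$ induced on the vertices of degree at least $r$ in $G$, and $\mathcal{H}(G) = G^{\geq \chi(G)}$. $\Delta(G)$ is the maximum degree and $\chi(G)$ the chromatic number. *)

(* Defs.v *)
From mathcomp Require Import all_boot.
Set Implicit Arguments. Unset Strict Implicit. Unset Printing Implicit Defensive.

Section Graphs.
Variable T : finType.
Variable e : rel T.

Definition simple_graph : Prop := symmetric e /\ irreflexive e.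

Definition colorable_on (S : {set T}) (k : nat) : bool :=
  [exists f : {ffun T -> 'I_k},
     [forall x in S, forall y in S, e x y ==> (f x != f y)]].

(* chromatic number of the subgraph induced on S: least k <= #|T| such that
   G[S] is k-colourable (a simple graph on T is always #|T|-colourable). *)
Definition chi_on (S : {set T}) : nat :=
  \big[minn/#|T|]_(k < #|T|.+1 | colorable_on S k) (k : nat).

Definition chi : nat := chi_on setT.

Definition deg (x : T) : nat := #|[set y | e x y]|.

Definition maxdeg : nat := \max_(x : T) deg x.

Definition vertex_critical : Prop :=
  forall v : T, chi_on (setT :\ v) < chi.

Definition high_vertices : {set T} := [set x | chi <= deg x].

Definition H_edgeless : Prop :=
  forall x y, x \in high_vertices -> y \in high_vertices -> ~~ e x y.

Definition is_complete_graph (n : nat) : Prop :=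
  #|T| = n /\ forall x y : T, x != y -> e x y.

End Graphs.

(* Main.v *)
(** Write c for the chromatic number. All vertices have degree at least c - 1,
    those of degree exactly c - 1 are "low", and the others are independent and
    of degree at most c + k - 1. Put r_i >= 3 (i <= k) with sum c - 1 and choose,
    as in Lovasz's decomposition theorem, a partition into parts V_i minimising
    the sum of e(V_i) - r_i |V_i|, and then the number of K_{r_i + 1} inside
    some V_i. Each V_i has maximum degree at most r_i, so by Brooks' theorem some
    V_i contains a component A = K_{r_i + 1}. A low vertex of A can be moved to
    any V_j without losing optimality, and completes a K_{r_j + 1} there. A walk
    alternating between two parts shows that all low vertices of A have the same
    neighbours in V_j; therefore the closed neighbourhood F of a low vertex v of
    A has c vertices, and each of its low vertices is adjacent to all of F. If F
    has two non-low vertices, they have at most 4k < c - 1 neighbours besides the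
    low vertices of F, so in a (c - 1)-colouring of the rest they can share a
    colour, and this extends greedily to the low vertices of F. Hence
    F is a K_c, and it is everything by criticality. Brooks' theorem is proved
    by Zajac's argument: colour greedily along a maximal path, or along the
    cycle closed by its last vertex. *)

Require Import Defs.
From mathcomp Require Import all_boot zify.

Set Implicit Arguments.
Unset Strict Implicit.
Unset Printing Implicit Defensive.

Lemma card_gt2_other (T : finType) (B : {set T}) x y : 2 < #|B| ->
  exists u, [/\ u \in B, u != x & u != y].
Proof.
move=> lt2; have /card_gt0P[u] : 0 < #|B :\: [set x; y]|.
  rewrite cardsD subn_gt0; apply: leq_trans lt2.
  apply: leq_ltn_trans (subset_leq_card (subsetIr _ _)) _.
  by rewrite cards2; case: (_ != _).
by rewrite !inE negb_or => /andP[/andP[? ?] ?]; exists u.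
Qed.

(** * Proper colourings of induced subgraphs and the chromatic number *)

Section Colouring.
Variables (T : finType) (e : rel T).
Hypotheses (eC : symmetric e) (eI : irreflexive e).

Definition nbrs (D : {set T}) (v : T) : {set T} := [set w in D | e v w].

Definition clique (A : {set T}) : Prop :=
  forall x y, x \in A -> y \in A -> x != y -> e x y.

Definition proper_on (C : finType) (f : T -> C) (D : {set T}) : Prop :=
  forall x y, x \in D -> y \in D -> e x y -> f x != f y.

Lemma nbrs_subset (D1 D2 : {set T}) v :
  D1 \subset D2 -> nbrs D1 v \subset nbrs D2 v.
Proof.
move=> sD; apply/subsetP => w; rewrite !inE => /andP[w1 ->].
by rewrite (subsetP sD).
Qed.

Lemma adj_neq x y : e x y -> x != y.
Proof. by apply: contraTneq => ->; rewrite eI. Qed.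

Lemma proper_onS (C : finType) (f : T -> C) (D1 D2 : {set T}) :
  D1 \subset D2 -> proper_on f D2 -> proper_on f D1.
Proof. by move=> /subsetP sD pf x y xD yD; apply: pf; apply: sD. Qed.

Lemma colorable_onP (S : {set T}) n :
  reflect (exists f : T -> 'I_n, proper_on f S) (colorable_on e S n).
Proof.
apply: (iffP existsP) => [[f pf]|[f pf]].
  exists f => x y xS yS.
  by move/forall_inP: pf => /(_ x xS) /forall_inP /(_ y yS) /implyP.
exists [ffun x => f x]; apply/forall_inP => x xS; apply/forall_inP => y yS.
by apply/implyP => exy; rewrite !ffunE; apply: pf.
Qed.

Lemma proper_colorable (C : finType) (f : T -> C) (S : {set T}) n :
  #|C| <= n -> proper_on f S -> colorable_on e S n.
Proof.
move=> leCn pf; apply/colorable_onP.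
exists (fun x => widen_ord leCn (enum_rank (f x))) => x y xS yS exy.
apply: contra (pf x y xS yS exy) => /eqP/(congr1 val)/= eq_xy.
by apply/eqP/enum_rank_inj/val_inj.
Qed.

Lemma colorable_onW (S1 S2 : {set T}) n1 n2 :
  S1 \subset S2 -> n1 <= n2 -> colorable_on e S2 n1 -> colorable_on e S1 n2.
Proof.
move=> sS le12 /colorable_onP[f pf].
by apply: (@proper_colorable _ f); [rewrite card_ord|apply: proper_onS pf].
Qed.

Lemma colorable_chi_on (S : {set T}) : colorable_on e S (chi_on e S).
Proof.
rewrite /chi_on; elim/big_ind: _ => // [|x y cx cy].
  apply: (@proper_colorable _ id) => // x y _ _; exact: adj_neq.
by rewrite /minn; case: ifP.
Qed.

Lemma chi_on_le (S : {set T}) n : colorable_on e S n -> chi_on e S <= n.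
Proof.
move=> cn; rewrite /chi_on; case: (leqP n #|T|) => [le_nT|/ltnW lt_Tn].
  have: Ordinal (le_nT : n < #|T|.+1) \in index_enum 'I_#|T|.+1.
    exact: mem_index_enum.
  elim: (index_enum _) => //= i s IH; rewrite inE big_cons.
  case/predU1P => [<-|/IH le_s]; first by rewrite cn geq_minl.
  by case: ifP => // _; apply: leq_trans (geq_minr _ _) le_s.
(* Here [n] exceeds every index of the minimum, which is however at most its default value
   [#|T|]. *)
apply: leq_trans lt_Tn; elim/big_ind: _ => // [x y xT _|i _].
  exact: leq_trans (geq_minl _ _) xT.
exact: (ltn_ord i).
Qed.

(** * Greedy colouring along paths *)

(** The bound is on the colours seen, not on the neighbours, so that it also serves for a vertex
    with two neighbours of the same colour. *)
Lemma extend_one n (f : T -> 'I_n) (D : {set T}) v :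
  proper_on f D -> v \notin D -> #|f @: nbrs D v| < n ->
  exists2 g : T -> 'I_n, proper_on g (v |: D) & {in D, g =1 f}.
Proof.
move=> pf vD lt_n.
have [c cN] : exists c, c \notin f @: nbrs D v.
  apply/existsP; apply: contraTT lt_n => /existsPn allf.
  rewrite -leqNgt -{1}[n]card_ord; apply/subset_leq_card/subsetP => c _.
  by move: (allf c); rewrite negbK.
exists (fun x => if x == v then c else f x); last first.
  by move=> x xD; case: eqP => // xv; rewrite -xv xD in vD.
have cP y : y \in D -> e v y -> c != f y.
  move=> yD evy; apply: contraNneq cN => ->; apply: imset_f.
  by rewrite inE yD.
move=> x y; rewrite !inE => xD yD exy.
case: (eqVneq x v) xD exy => [->|xv] /= xD exy.
  case: (eqVneq y v) yD exy => [->|yv] /= yD; first by rewrite eI.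
  exact: cP.
case: (eqVneq y v) yD exy => [->|yv] /= yD exy; last exact: pf.
by rewrite eq_sym cP // eC.
Qed.

Lemma card_colours_lt (n d : nat) (f : T -> 'I_n) (A : {set T}) :
  #|A| < d -> #|f @: A| < d.
Proof. exact: leq_ltn_trans (leq_imset_card _ _). Qed.

Lemma card_colours_repeat n (f : T -> 'I_n) (A : {set T}) x y :
  x \in A -> y \in A -> x != y -> f x = f y -> #|f @: A| < #|A|.
Proof.
move=> xA yA xy fxy; rewrite ltn_neqAle leq_imset_card andbT.
apply: contra xy => /imset_injP inj; apply/eqP; exact: inj.
Qed.

(* Every vertex of the path but the last still has its successor uncoloured
   when its turn comes, so it sees at most [n - 1] colours. *)
Lemma greedy_path n (S D : {set T}) (f : T -> 'I_n) x p :
  (forall v, v \in S -> #|nbrs S v| <= n) ->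
  D \subset S -> {subset x :: p <= S} -> proper_on f D ->
  path e x p -> uniq (x :: p) -> (forall v, v \in x :: p -> v \notin D) ->
  exists2 g : T -> 'I_n,
    proper_on g (D :|: [set v in belast x p]) & {in D, g =1 f}.
Proof.
move=> degS; elim: p x D f => [|y p IH] x D f sDS sS pf.
  move=> _ _ _; exists f => //; apply: proper_onS pf.
  by apply/subsetP => v; rewrite !inE orbF.
move=> /= /andP[exy pth] /andP[xN un] dis.
have xS : x \in S by apply: sS; rewrite mem_head.
have xD : x \notin D by apply: dis; rewrite mem_head.
have lt_n : #|f @: nbrs D x| < n.
  apply: card_colours_lt; apply: leq_trans (degS x xS); apply: proper_card.
  apply/properP; split; first exact: nbrs_subset.
  exists y; first by rewrite inE exy sS // !inE eqxx orbT.
  by rewrite inE (negbTE (dis y _)) // !inE eqxx orbT.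
have [g pg gf] := extend_one pf xD lt_n.
have [|v vp|//|//|//|v vp|h ph hg] := IH y (x |: D) g.
- by rewrite subUset sub1set xS.
- by apply: sS; rewrite inE vp orbT.
- rewrite !inE negb_or dis ?andbT; last by rewrite inE vp orbT.
  by apply: contraNneq xN => <-.
exists h; last by move=> v vD; rewrite hg ?gf // !inE vD orbT.
apply: proper_onS ph; apply/subsetP => v; rewrite !inE.
by case: (v == x); rewrite ?orbT.
Qed.

(** Extension at the last vertex must stop within [#|S|] vertices. The prefix [x :: p] is kept
    because [brooks] prescribes how the path starts. *)
Lemma maximal_path (S : {set T}) x p :
  path e x p -> uniq (x :: p) -> {subset x :: p <= S} ->
  exists q, [/\ path e x (p ++ q), uniq (x :: p ++ q),
    {subset x :: p ++ q <= S} &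
    {subset nbrs S (last x (p ++ q)) <= x :: p ++ q}].
Proof.
have [n] := ubnP (#|S| - size p); elim: n p => // n IH p le_n pth un sub.
have [sub_last|/subsetPn[y]] :=
  boolP (nbrs S (last x p) \subset [set v in x :: p]).
  exists [::]; rewrite cats0; split=> // y /(subsetP sub_last).
  by rewrite inE.
rewrite !inE => /andP[yS ely] /norP[yx yp].
have un' : uniq (x :: rcons p y).
  by move: un; rewrite /= mem_rcons inE eq_sym negb_or yx /= rcons_uniq yp.
have sub' : {subset x :: rcons p y <= S}.
  move=> v; rewrite inE mem_rcons inE orbCA => /predU1P[->//|vp].
  by apply: sub; rewrite inE.
have le_S : size (rcons p y) < #|S|.
  have := uniq_leq_size un' (_ : {subset _ <= enum S}); rewrite -cardE; apply.
  by move=> v /sub'; rewrite mem_enum.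
case: (IH (rcons p y)) => // [||q]; last first.
- by rewrite cat_rcons => ?; exists (y :: q).
- by rewrite rcons_path pth.
- by move: le_S le_n; rewrite size_rcons; lia.
Qed.

(** Variant of [greedy_path] that names the uncoloured last vertex [l] and allows [p] to be
    empty. *)
Lemma greedy_seq n (S D : {set T}) (f : T -> 'I_n) p l :
  (forall v, v \in S -> #|nbrs S v| <= n) ->
  D \subset S -> {subset rcons p l <= S} -> proper_on f D ->
  sorted e (rcons p l) -> uniq (rcons p l) ->
  (forall v, v \in rcons p l -> v \notin D) ->
  exists2 g : T -> 'I_n,
    proper_on g (D :|: [set v in p]) & {in D, g =1 f}.
Proof.
case: p => [|x p] degS sDS sS pf.
  move=> _ _ _; exists f => //; apply: proper_onS pf.
  by apply/subsetP => v; rewrite !inE orbF.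
move=> srt un dis.
have [g] := greedy_path degS sDS sS pf srt un dis.
by rewrite belast_rcons; exists g.
Qed.

(** * Brooks' theorem *)

Lemma sorted_rev s : sorted e (rev s) = sorted e s.
Proof. by rewrite rev_sorted; apply: eq_sorted => x y; exact: eC. Qed.

Lemma not_clique (A : {set T}) :
  ~ clique A -> exists x y, [/\ x \in A, y \in A, x != y & ~~ e x y].
Proof.
move=> nA.
have [/existsP[x /existsP[y /and4P[]]]|none] :=
  boolP [exists x, exists y, [&& x \in A, y \in A, x != y & ~~ e x y]].
  by exists x, y.
case: nA => x y xA yA xy; apply: contraNT none => nexy.
by apply/existsP; exists x; apply/existsP; exists y; apply/and4P.
Qed.

Lemma first_switch (a : pred T) l s :
  ~~ a l -> has a (l :: s) ->
  exists t1 w' w t2, [/\ l :: s = t1 ++ w' :: w :: t2, ~~ a w' & a w].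
Proof.
elim: s l => [|b s IH] l nal; first by rewrite /= (negbTE nal).
have [ab _|nab] := boolP (a b); first by exists [::], l, b, s.
rewrite /= (negbTE nal) => /(IH b nab)[t1 [w' [w [t2 [-> nw' aw]]]]].
by exists (l :: t1), w', w, t2.
Qed.

Lemma brooks r (S : {set T}) :
  2 < r -> (forall v, v \in S -> #|nbrs S v| <= r) ->
  (forall A : {set T}, A \subset S -> clique A -> #|A| <> r.+1) ->
  exists f : T -> 'I_r, proper_on f S.
Proof.
move=> r2; have [n] := ubnP #|S|; elim: n S => // n IH S le_n degS noK.
have IHS (S' : {set T}) : S' \proper S -> exists f : T -> 'I_r, proper_on f S'.
  move=> prS; have sS := proper_sub prS; apply: IH.
  - by have := proper_card prS; lia.
  - move=> v vS'; apply: leq_trans (degS v _); last exact: (subsetP sS).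
    exact/subset_leq_card/nbrs_subset.
  - by move=> A sA; apply: noK; apply: subset_trans sA sS.
have r0 : 0 < r by lia.
(* A vertex with fewer than [r] neighbours can be coloured last, so [S] may be taken [r]-regular. *)
have [/exists_inP[v vS lt_v]|/exists_inPn regS] :=
  boolP [exists v in S, #|nbrs S v| < r].
  have [f pf] := IHS _ (properD1 vS).
  have [||g pg _] := @extend_one _ f (S :\ v) v pf.
  - by rewrite !inE eqxx.
  - apply: card_colours_lt; apply: leq_ltn_trans lt_v.
    exact/subset_leq_card/nbrs_subset/subD1set.
  - by exists g; rewrite -(setD1K vS).
have {}regS v : v \in S -> #|nbrs S v| = r.
  by move=> vS; have := regS v vS; have := degS v vS; lia.
have [S0|[v vS]] := set_0Vmem S.
  by exists (fun=> Ordinal r0) => x y; rewrite S0 inE.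
(* Otherwise [v] and its [r] neighbours would form a forbidden clique. *)
have [x [y [xN yN xy nexy]]] : exists x y,
    [/\ x \in nbrs S v, y \in nbrs S v, x != y & ~~ e x y].
  apply: not_clique => clN; apply: (noK (v |: nbrs S v)).
  - rewrite subUset sub1set vS; apply/subsetP => z; by rewrite inE => /andP[].
  - move=> a b; rewrite !inE.
    case/predU1P => [->|/andP[aS eva]] /predU1P[->|/andP[bS evb]] //.
    + by rewrite eqxx.
    + by rewrite eC.
    + by move=> ab; apply: clN => //; rewrite inE ?aS ?bS.
  - by rewrite cardsU1 regS // inE eI andbF.
have [xS evx] : x \in S /\ e v x by move: xN; rewrite inE => /andP.
have [yS evy] : y \in S /\ e v y by move: yN; rewrite inE => /andP.
have [|||q [pth un sub max]] := @maximal_path S x [:: v; y].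
- by rewrite /= eC evx evy.
- by rewrite /= !inE negb_or xy andbT eq_sym (adj_neq evx) adj_neq.
- by move=> z; rewrite !inE => /or3P[] /eqP->.
have [vx yv] := (adj_neq evx, adj_neq evy).
have [xq vq yq unq] : [/\ x \notin q, v \notin q, y \notin q & uniq q].
  move: un; rewrite /= !inE !negb_or.
  by case/and4P=> /and3P[_ _ xq] /andP[_ vq] yq unq; split.
(* If the path covers [S], then [x] and [y] get the same colour and [v] is coloured last. A third
   neighbour [z] of [v], which exists as [2 < r], lies on the tail [q]. *)
have [/subsetP cov|/subsetPn[u uS uN]] :=
  boolP (S \subset [set z in x :: [:: v; y] ++ q]).
  have [z zq evz] : exists2 z, z \in q & e v z.
    have [|z [zN zx zy]] := @card_gt2_other T (nbrs S v) x y; first by rewrite regS.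
    have [zS evz] : z \in S /\ e v z by move: zN; rewrite inE => /andP.
    exists z => //; have := cov z zS; rewrite !inE (negbTE zx) (negbTE zy) /=.
    by rewrite eq_sym (negbTE (adj_neq evz)).
  case/splitPr: zq pth unq xq vq yq sub {max un} (cov) => q1 q2.
  move=> /= /and3P[_ _ pth] unq xq vq yq sub {}cov.
  pose D0 := [set x; y].
  have sD0 : D0 \subset S by rewrite subUset !sub1set xS.
  have pf0 : proper_on (fun=> Ordinal r0) D0.
    move=> a b; rewrite !inE => /orP[] /eqP-> /orP[] /eqP->.
    - by rewrite eI.
    - by rewrite (negbTE nexy).
    - by rewrite eC (negbTE nexy).
    - by rewrite eI.
  have qS w : w \in q1 ++ z :: q2 -> w \in S.
    by move=> wq; apply: sub; rewrite !inE wq !orbT.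
  move: pth; rewrite -cat_rcons cat_path last_rcons => /andP[pth1 pth2].
  have := unq; rewrite -cat_rcons cat_uniq => /and3P[un1 dis un2].
  have qD0 w : w \in q1 ++ z :: q2 -> w \notin D0.
    move=> wq; rewrite !inE; apply/norP; split; [move: xq|move: yq];
      by apply: contraNneq => <-.
  have sub1 w : w \in rcons q1 z -> w \in q1 ++ z :: q2.
    by move=> wq; rewrite -cat_rcons mem_cat wq.
  (* The tail before [z] is coloured forwards, with [z] still uncoloured. *)
  have [w wq||w wq|f1 pf1 f1E] :=
    greedy_seq (p := q1) (l := z) degS sD0 _ pf0 _ un1.
  - exact/qS/sub1.
  - exact: path_sorted pth1.
  - exact/qD0/sub1.
  have := un1; rewrite rcons_uniq => /andP[zq1 _].
  have sub2 w : w \in z :: q2 -> w \in q1 ++ z :: q2.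
    by move=> wq; rewrite mem_cat wq orbT.
  pose D1 := D0 :|: [set w in q1].
  have sD1 : D1 \subset S.
    rewrite subUset sD0; apply/subsetP => w; rewrite inE => wq1.
    by apply: qS; rewrite mem_cat wq1.
  have vD1 : v \notin D1.
    rewrite !inE (negbTE vx) (negbTE yv) /=.
    by apply: contra vq => vq1; rewrite mem_cat vq1.
  have disD1 w : w \in z :: q2 -> w \notin D1.
    move=> wq; rewrite in_setU (negbTE (qD0 w (sub2 w wq))) /= inE.
    move: wq; rewrite inE => /predU1P[->//|wq2].
    apply: contra dis => wq1; apply/hasP; exists w => //.
    by rewrite mem_rcons inE wq1 orbT.
  have memr w : (w \in rcons (rev (z :: q2)) v) = (w == v) || (w \in z :: q2).
    by rewrite mem_rcons inE mem_rev.
  (* The rest is coloured backwards, from the end of the path down to [z], whose neighbour [v] is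
     still uncoloured. *)
  have [w|||w|f2 pf2 f2E] :=
    greedy_seq (p := rev (z :: q2)) (l := v) degS sD1 _ pf1.
  - by rewrite memr => /predU1P[->//|/sub2/qS].
  - by rewrite -rev_cons sorted_rev /= evz.
  - rewrite -rev_cons rev_uniq cons_uniq.
    move: unq; rewrite cat_uniq => /and3P[_ _ ->]; rewrite andbT.
    by apply: contra vq => /sub2.
  - by rewrite memr => /predU1P[->|/disD1].
  pose D2 := D1 :|: [set w in rev (z :: q2)].
  have sD2 : D2 \subset S.
    rewrite subUset sD1; apply/subsetP => w; rewrite inE mem_rev.
    by move/sub2/qS.
  have vD2 : v \notin D2.
    rewrite in_setU (negbTE vD1) inE mem_rev; apply: contra vq; exact: sub2.
  have xD2 : x \in nbrs D2 v by rewrite !inE eqxx evx.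
  have yD2 : y \in nbrs D2 v by rewrite !inE eqxx evy !orbT.
  have f2xy : f2 x = f2 y.
    by rewrite !f2E ?f1E // !inE eqxx ?orbT.
  have lt_r : #|f2 @: nbrs D2 v| < r.
    apply: leq_trans (card_colours_repeat xD2 yD2 xy f2xy) (leq_trans _ (degS v vS)).
    exact/subset_leq_card/nbrs_subset.
  have [g pg _] := extend_one pf2 vD2 lt_r.
  exists g; apply: proper_onS pg; apply/subsetP => w /cov.
  rewrite !inE mem_rev !mem_cat !inE.
  by case/or4P => [->|->|->|/or3P[]->]; rewrite ?orbT.
set s := x :: _ in pth un sub max uN; rewrite inE in uN.
set l := last x _ in max.
have ls : l \in s by rewrite mem_last.
have lS : l \in S by apply: sub.
have hasl : has (e l) s.
  have /card_gt0P[a aN] : 0 < #|nbrs S l| by rewrite regS.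
  by apply/hasP; exists a; [apply: max|move: aN; rewrite inE => /andP[]].
have srt : sorted e s by [].
have lastE : forall d, last d s = l by [].
clearbody s l.
(* The path from the first neighbour [a] of [l] up to [l] closes to a cycle, which contains all
   neighbours of [l] in [S]. *)
case/split_find: hasl srt un sub uN lastE max => a s1 s2 ela nos1.
rewrite cat_rcons => srt un sub uN lastE max.
have lE : l = last a s2 by rewrite -(lastE x) last_cat.
have [pth2 un2] : path e a s2 /\ uniq (a :: s2).
  move: un; rewrite cat_uniq => /and3P[_ _ ->]; split=> //.
  case: (s1) srt => //= b s3; rewrite cat_path /=.
  by case/and3P.
pose c := l :: belast a s2.
have cE : rotr 1 (a :: s2) = c by rewrite lastI rotr1_rcons -lE.
have cyc : cycle e c by rewrite -cE rotr_cycle /= rcons_path pth2 -lE.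
have unc : uniq c by rewrite -cE rotr_uniq.
have memc w : (w \in c) = (w \in a :: s2) by rewrite -cE mem_rotr.
have sc w : w \in c -> w \in S.
  by rewrite memc => wc; apply: sub; rewrite mem_cat wc orbT.
have uc : u \notin c.
  by rewrite memc; apply: contra uN; rewrite mem_cat => ->; rewrite orbT.
pose out w := [exists w', [&& w' \in S, w' \notin c & e w w']].
have noutl : ~~ out l.
  apply/existsP => -[w /and3P[wS wc elw]]; case/negP: wc; rewrite memc.
  have : w \in s1 ++ a :: s2 by apply: max; rewrite inE wS.
  by rewrite mem_cat => /orP[ws1|//]; case/hasP: nos1; exists w.
pose C := [set w in c].
have CS : C \subset S by apply/subsetP => w; rewrite inE; exact: sc.
have [|f pf] := IHS (S :\: C).
  by apply/properP; split; [exact: subsetDl|exists l => //; rewrite !inE eqxx].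
have noutP w w' : ~~ out w -> w' \in S -> w' \notin c -> ~~ e w w'.
  move=> nw w'S w'c; apply: contra nw => eww'; apply/existsP.
  by exists w'; rewrite w'S w'c.
(* If no edge leaves the cycle inside [S], the cycle and the rest are coloured independently; [u]
   shows that the cycle is not all of [S]. *)
have [hasout|noout] := boolP (has out c); last first.
  have [|f1 pf1] := IHS C.
    by apply/properP; split=> //; exists u; rewrite ?inE.
  exists (fun w => if w \in c then f1 w else f w) => w w' wS w'S eww'.
  have nout w1 : w1 \in c -> ~~ out w1.
    by move=> w1c; apply: contra noout => o; apply/hasP; exists w1.
  case: ifPn => wc; case: ifPn => w'c.
  - by apply: pf1; rewrite ?inE.
  - by case/negP: (noutP w w' (nout w wc) w'S w'c).
  - by case/negP: (noutP w' w (nout w' w'c) wS wc); rewrite eC.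
  - by apply: pf; rewrite ?inE ?wc ?w'c.
(* Two consecutive vertices of the cycle such that [w] has a neighbour off the cycle and [w'] has
   none. *)
have [t1 [w' [w [t2 [cdef nw' ow]]]]] := first_switch noutl hasout.
rewrite -/c in cdef.
clear cE; clearbody c.
have := cyc; have := unc; rewrite -(rot_cycle (size t1).+1) -(rot_uniq (size t1).+1).
rewrite cdef -cat_rcons -(size_rcons t1 w') rot_size_cat.
set t := t2 ++ t1; have -> : (w :: t2) ++ rcons t1 w' = rcons (w :: t) w'.
  by rewrite /t -rcons_cat.
move=> unt /=; rewrite rcons_path last_rcons rcons_path.
case/andP=> /andP[ptht _] ew'w.
have memt z : (z \in c) = [|| z == w', z == w | z \in t].
  by rewrite cdef /t !mem_cat !inE; do !case: (_ == _); do !case: (_ \in _).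
move: unt; rewrite rcons_uniq => /andP[w'N unt].
have [w'c wc] : w' \in c /\ w \in c by rewrite !memt !eqxx orbT.
case/existsP: ow => u0 /and3P[u0S u0c ewu0].
(* Having no neighbour off the cycle, [w'] can take the colour of [u0]. The cycle is then coloured
   from the side of [w'] towards [w], which finally sees this colour twice. *)
pose f1 z := if z == w' then f u0 else f z.
pose D1 := w' |: (S :\: C).
have w'S := sc _ w'c; have wS := sc _ wc.
have f1E z : z \notin c -> f1 z = f z.
  by move=> zc; rewrite /f1; case: eqP zc => // ->; rewrite w'c.
have pf1 : proper_on f1 D1.
  have nb z : z \in S :\: C -> e w' z = false.
    by rewrite !inE => /andP[zc zS]; apply/negbTE/(noutP w' z).
  move=> z1 z2; rewrite !in_setU1.
  case/predU1P => [->|z1D] /predU1P[->|z2D]; first by rewrite eI.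
  - by rewrite nb.
  - by rewrite eC nb.
  - move: (z1D) (z2D); rewrite !inE => /andP[z1c _] /andP[z2c _].
    by rewrite !f1E //; apply: pf.
have sD1 : D1 \subset S by rewrite subUset sub1set w'S subsetDl.
have memr z : (z \in rcons (rev t) w) = (z \in w :: t).
  by rewrite mem_rcons !inE mem_rev.
have memwt z : z \in w :: t -> z \in c by rewrite memt inE => ->; rewrite orbT.
have disD1 z : z \in w :: t -> z \notin D1.
  move=> zt; rewrite !inE (memwt z zt) /= orbF.
  by apply: contraNneq w'N => <-.
have [z|||z|g pg gE] := greedy_seq (p := rev t) (l := w) degS sD1 _ pf1.
- by rewrite memr => /memwt/sc.
- by rewrite -rev_cons sorted_rev.
- by rewrite -rev_cons rev_uniq.
- by rewrite memr => /disD1.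
pose D2 := D1 :|: [set z in rev t].
have sD2 : D2 \subset S.
  rewrite subUset sD1; apply/subsetP => z; rewrite inE mem_rev => zt.
  by apply/sc/memwt; rewrite inE zt orbT.
have wD2 : w \notin D2.
  rewrite in_setU (negbTE (disD1 _ _)) ?mem_head // inE mem_rev.
  by case/andP: unt.
have u0D1 : u0 \in D1 by rewrite !inE u0S u0c orbT.
have w'D1 : w' \in D1 by rewrite !inE eqxx.
have u0D2 : u0 \in nbrs D2 w by rewrite inE ewu0 in_setU u0D1.
have w'D2 : w' \in nbrs D2 w by rewrite inE eC ew'w in_setU w'D1.
have neq : u0 != w' by apply: contraNneq u0c => ->.
have geq : g u0 = g w' by rewrite !gE // f1E // /f1 eqxx.
have lt_r : #|g @: nbrs D2 w| < r.
  apply: leq_trans (card_colours_repeat u0D2 w'D2 neq geq) (leq_trans _ (degS w wS)).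
  exact/subset_leq_card/nbrs_subset.
have [h ph _] := extend_one pg wD2 lt_r.
exists h; apply: proper_onS ph; apply/subsetP => z zS.
rewrite !inE mem_rev zS memt.
by do !case: (_ == _); case: (_ \in _).
Qed.

End Colouring.

(** * Partitions of minimal potential, after Lovász *)

Section Partitions.
Variables (T : finType) (e : rel T) (m : nat) (r : 'I_m -> nat).
Hypotheses (eC : symmetric e) (eI : irreflexive e).
Local Notation R := (\sum_i r i).
Local Notation part := {ffun T -> 'I_m}.
Implicit Types (P Q : part) (A B : {set T}).

Definition part_nbrs P i v : {set T} := [set w | e v w & P w == i].

Definition full_clique P i A : bool :=
  [&& #|A| == (r i).+1, [forall x in A, P x == i] &
      [forall x in A, forall y in A, (x != y) ==> e x y]].

Definition full_cliques P : {set {set T}} :=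
  [set A | [exists i, full_clique P i A]].

Definition move P v j : part := [ffun x => if x == v then j else P x].

(* Up to the constant [2 * #|T| * R], this is twice
   [\sum_i (edges inside part i - r i * size of part i)]. *)
Definition potential P : nat :=
  \sum_v #|part_nbrs P (P v) v| + 2 * \sum_v (R - r (P v)).

Definition potential_min P : Prop := forall Q, potential P <= potential Q.

Definition optimal P : Prop :=
  potential_min P /\
  forall Q, potential Q = potential P -> #|full_cliques P| <= #|full_cliques Q|.

Lemma full_cliqueP P i A :
  reflect [/\ #|A| = (r i).+1, forall x, x \in A -> P x = i &
    forall x y, x \in A -> y \in A -> x != y -> e x y] (full_clique P i A).
Proof.
apply: (iffP and3P) => [[/eqP-> /forall_inP PA /forall_inP eA]|[-> PA eA]].
  split=> // [x xA|x y xA yA xy]; first exact/eqP/PA.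
  by move/forall_inP: (eA x xA) => /(_ y yA)/implyP/(_ xy).
split=> //; first by apply/forall_inP => x xA; apply/eqP/PA.
by apply/forall_inP => x xA; apply/forall_inP => y yA; apply/implyP; exact: eA.
Qed.

Lemma moveE P v j x : move P v j x = if x == v then j else P x.
Proof. by rewrite ffunE. Qed.

Lemma move_same P v j : move P v j v = j.
Proof. by rewrite moveE eqxx. Qed.

Lemma move_other P v j x : x != v -> move P v j x = P x.
Proof. by rewrite moveE => /negbTE->. Qed.

Lemma part_nbrs_move_self P v j i :
  part_nbrs (move P v j) i v = part_nbrs P i v.
Proof. by apply/setP => u; rewrite !inE moveE; case: (u =P v) => // ->; rewrite eI. Qed.

Lemma sum_deg_parts P v : deg e v = \sum_i #|part_nbrs P i v|.
Proof.
rewrite /deg -sum1dep_card (partition_big P predT) //=.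
by apply: eq_bigr => i _; rewrite -sum1dep_card.
Qed.

Lemma r_le_R i : r i <= R.
Proof. by rewrite (bigD1 i) //= leq_addr. Qed.

(** Only the edge between [u] and [v] can change the count; corrections on both sides avoid
    truncated subtraction. *)
Lemma card_part_nbrs_move P v j u : u != v ->
  #|part_nbrs (move P v j) (P u) u| + (e u v && (P u == P v)) =
  #|part_nbrs P (P u) u| + (e u v && (P u == j)).
Proof.
move=> uv; rewrite (cardsD1 v (part_nbrs P _ _)).
rewrite (cardsD1 v (part_nbrs (move _ _ _) _ _)).
have -> : part_nbrs (move P v j) (P u) u :\ v = part_nbrs P (P u) u :\ v.
  by apply/setP => w; rewrite !inE moveE; case: (w =P v).
by rewrite !inE move_same !(eq_sym _ (P u)); lia.
Qed.

Lemma card_part_nbrs_sum P v i :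
  \sum_(u | u != v) (e u v && (P u == i)) = #|part_nbrs P i v|.
Proof.
rewrite -sum1_card [RHS]big_mkcond [RHS](bigD1 v) //= inE eI add0n.
by apply: eq_bigr => u _; rewrite inE eC; case: (_ && _).
Qed.

(** The vertex gives up its edges into its old part and gains those into part [j]; the potential
    counts each of them from both ends. *)
Lemma potential_move P v j :
  potential (move P v j) + 2 * #|part_nbrs P (P v) v| + 2 * (R - r (P v)) =
  potential P + 2 * #|part_nbrs P j v| + 2 * (R - r j).
Proof.
have WE : \sum_u (R - r (move P v j u)) + (R - r (P v)) =
          \sum_u (R - r (P u)) + (R - r j).
  rewrite (bigD1 v) // [in RHS](bigD1 v) //= move_same.
  have -> : \sum_(u | u != v) (R - r (move P v j u)) =
            \sum_(u | u != v) (R - r (P u)).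
    by apply: eq_bigr => u uv; rewrite move_other.
  by rewrite addnAC [RHS]addnAC; congr (_ + _); apply: addnC.
have EE : \sum_u #|part_nbrs (move P v j) (move P v j u) u|
            + 2 * #|part_nbrs P (P v) v| =
          \sum_u #|part_nbrs P (P u) u| + 2 * #|part_nbrs P j v|.
  rewrite (bigD1 v) // [in RHS](bigD1 v) //= move_same part_nbrs_move_self.
  have := card_part_nbrs_sum P v j; have := card_part_nbrs_sum P v (P v).
  have : \sum_(u | u != v) (#|part_nbrs (move P v j) (move P v j u) u|
           + (e u v && (P u == P v))) =
         \sum_(u | u != v) (#|part_nbrs P (P u) u| + (e u v && (P u == j))).
    by apply: eq_bigr => u uv; rewrite move_other // card_part_nbrs_move.
  by rewrite !big_split /=; lia.
by rewrite /potential; lia.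
Qed.

Lemma optimal_exists (i0 : 'I_m) : exists P, optimal P.
Proof.
case: (@arg_minnP _ [ffun=> i0] predT potential) => // P0 _ minP0.
case: (@arg_minnP _ P0 (fun P => potential P == potential P0)
         (fun P => #|full_cliques P|)) => // P /eqP eqP minP.
exists P; split=> [Q|Q eqQ]; first by rewrite eqP; apply: minP0.
by apply: minP; rewrite eqQ eqP.
Qed.

Hypothesis deg_bound : forall v, deg e v < \sum_i (r i).+1.

(** The excess of the number of neighbours over [r] is least in the part of [v] itself, since a move
    cannot lower the potential. *)
Lemma potential_min_move P v j : potential_min P ->
  #|part_nbrs P (P v) v| + r j <= #|part_nbrs P j v| + r (P v).
Proof.
move=> minP; have := minP (move P v j); have := potential_move P v j.
by have := r_le_R j; have := r_le_R (P v); lia.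
Qed.

(** A positive excess in the part of [v] would be positive in every part, against [deg_bound]. *)
Lemma potential_min_degree P v :
  potential_min P -> #|part_nbrs P (P v) v| <= r (P v).
Proof.
move=> minP; rewrite leqNgt; apply/negP => gt_r.
have := deg_bound v; rewrite (sum_deg_parts P) ltnNge; case/negP.
by apply: leq_sum => i _; have := potential_min_move v i minP; lia.
Qed.

(* The degree bound makes a full clique a connected component of its part. *)
Lemma full_clique_nbrs P i A v : potential_min P ->
  full_clique P i A -> v \in A -> part_nbrs P i v = A :\ v.
Proof.
move=> minP /full_cliqueP[cA PA eA] vA; apply/esym/eqP; rewrite eqEcard.
apply/andP; split.
  apply/subsetP => w; rewrite !inE => /andP[wv wA].
  by rewrite PA // eqxx eA // eq_sym.
have := potential_min_degree v minP; rewrite PA //.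
by have := cardsD1 v A; rewrite vA cA; lia.
Qed.

(** * Moving low vertices of full cliques *)

Hypothesis r_ge3 : forall i, 2 < r i.
Hypothesis high_indep :
  forall x y, deg e x != R -> deg e y != R -> ~~ e x y.

Definition low v := deg e v == R.

Lemma clique_lows B : clique e B ->
  #|B :\: [set v | low v]| <= 1.
Proof.
move=> cB; rewrite leqNgt; apply/negP => /card_gt1P[x [y []]].
rewrite !inE => /andP[lx xB] /andP[ly yB] xy.
by have := high_indep lx ly; rewrite cB.
Qed.

Lemma clique_low_exists B : clique e B ->
  1 < #|B| -> exists2 v, v \in B & low v.
Proof.
move=> cB lt1.
have /card_gt0P[v] : 0 < #|B :&: [set v | low v]|.
  by have := clique_lows cB; have := cardsID [set v | low v] B; lia.
by rewrite !inE => /andP[vB lv]; exists v.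
Qed.

(** Minimality and degree [R] leave [v] exactly [r j] neighbours in part [j], so the potential is
    unchanged. The move destroys [A]; as the number of full cliques was least, it must create one,
    and a new one contains [v] and hence consists of [v] and its neighbours in part [j]. *)
Lemma move_low P i A v j : optimal P -> full_clique P i A -> v \in A ->
  low v -> i != j ->
  optimal (move P v j) /\ full_clique (move P v j) j (v |: part_nbrs P j v).
Proof.
move=> [minP optP] bA vA lv ij.
have [cA PA eA] := full_cliqueP _ _ _ bA.
have Pv := PA v vA.
have di : #|part_nbrs P i v| = r i.
  by rewrite (full_clique_nbrs minP bA vA); have := cardsD1 v A; rewrite vA cA; lia.
have dge l : r l <= #|part_nbrs P l v|.
  by have := potential_min_move v l minP; rewrite Pv di; lia.
have dj : #|part_nbrs P j v| = r j.
  move: lv; rewrite /low (sum_deg_parts P) (bigD1 j) // [X in _ == X](bigD1 j) //=.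
  have : \sum_(l < m | l != j) r l <= \sum_(l < m | l != j) #|part_nbrs P l v|.
    exact: leq_sum.
  move: (\sum_(l < m | l != j) r l).
  move: (\sum_(l < m | l != j) #|part_nbrs P l v|) => s1 s2 le12 /eqP.
  by have := dge j; lia.
have potE : potential (move P v j) = potential P.
  have := potential_move P v j; rewrite Pv di dj.
  by have := r_le_R i; have := r_le_R j; lia.
set Q := move P v j in potE *.
have minQ : potential_min Q by move=> Q'; rewrite potE.
pose K := v |: part_nbrs P j v.
have sub : full_cliques Q \subset K |: (full_cliques P :\ A).
  apply/subsetP => B; rewrite !inE => /existsP[l bB].
  have [cB QB eB] := full_cliqueP _ _ _ bB.
  have [vB|vB] := boolP (v \in B).
    have lj : l = j by rewrite -(QB v vB) /Q move_same.
    have := full_clique_nbrs minQ bB vB.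
    by rewrite lj part_nbrs_move_self /K => ->; rewrite setD1K // eqxx.
  rewrite orbC; apply/orP; left; apply/andP; split.
    by apply: contraNneq vB => ->.
  apply/existsP; exists l; apply/full_cliqueP; split=> // x xB.
  by rewrite -(QB x xB) /Q move_other //; apply: contraNneq vB => <-.
have AP : A \in full_cliques P by rewrite inE; apply/existsP; exists i.
have cP : #|full_cliques P| = (#|full_cliques P :\ A|).+1.
  by rewrite (cardsD1 A) AP.
have leQ := optP Q potE.
have KQ : K \in full_cliques Q.
  apply: contraLR leQ => KQ; rewrite -ltnNge cP ltnS; apply: subset_leq_card.
  apply/subsetP => B BQ; have := subsetP sub B BQ.
  by rewrite in_setU1 => /predU1P[BK|//]; rewrite -BK BQ in KQ.
have cQ : #|full_cliques Q| = #|full_cliques P|.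
  apply/eqP; rewrite eqn_leq leQ andbT cP.
  by apply: leq_trans (subset_leq_card sub) _; rewrite cardsU1; case: (_ \in _).
split.
  by split=> // Q' eqQ'; rewrite cQ; apply: optP; rewrite eqQ'.
move: KQ; rewrite inE => /existsP[l bK].
have [_ QK _] := full_cliqueP _ _ _ bK.
have lj : l = j by rewrite -(QK v) /Q ?move_same // setU11.
by move: bK; rewrite lj.
Qed.

(** * The walk alternating between two parts *)

Section Walk.
Variables (P : part) (i j : 'I_m) (A : {set T}).
Hypotheses (optP : optimal P) (fullA : full_clique P i A) (ij : i != j).

Lemma part_nbrs_clique v x y : v \in A -> low v ->
  x \in part_nbrs P j v -> y \in part_nbrs P j v -> x != y -> e x y.
Proof.
move=> vA lv xN yN xy; have [_ /full_cliqueP[_ _]] := move_low optP fullA vA lv ij.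
by apply; rewrite // in_setU1 ?xN ?yN orbT.
Qed.

Lemma card_part_nbrs v : v \in A -> low v -> #|part_nbrs P j v| = r j.
Proof.
move=> vA lv; have [_ /full_cliqueP[+ _ _]] := move_low optP fullA vA lv ij.
by rewrite cardsU1 inE eI /= => -[].
Qed.

(** Once [v] is moved to part [j], it forms with these neighbours a full clique, hence a component
    of that part. *)
Lemma part_nbrs_closed v x u : v \in A -> low v ->
  x \in part_nbrs P j v -> e x u -> P u = j -> u \in part_nbrs P j v.
Proof.
move=> vA lv xN exu Pu; have [[minQ _] fullQ] := move_low optP fullA vA lv ij.
have Pv : P v = i by have [_ PA _] := full_cliqueP _ _ _ fullA; apply: PA.
have uv : u != v by apply: contraNneq ij => uv; rewrite -Pv -uv Pu.
have xQ : x \in v |: part_nbrs P j v by rewrite in_setU1 xN orbT.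
have := full_clique_nbrs minQ fullQ xQ => /setP/(_ u).
rewrite [LHS]inE exu move_other // Pu eqxx [RHS]in_setD1 in_setU1 (negbTE uv).
by move/esym/andP => [].
Qed.

(** Both sets are cliques closed under adjacency in part [j], so a common vertex makes them
    equal. *)
Lemma part_nbrs_eq v w x : v \in A -> low v -> w \in A -> low w ->
  x \in part_nbrs P j v -> x \in part_nbrs P j w ->
  part_nbrs P j v = part_nbrs P j w.
Proof.
move=> vA lv wA lw xv xw; apply/eqP; rewrite eqEcard.
rewrite !card_part_nbrs // leqnn andbT; apply/subsetP => u uv.
have [->//|ux] := eqVneq u x.
apply: part_nbrs_closed (xw) _ _ => //; last by move: uv; rewrite inE => /andP[_ /eqP].
by apply: part_nbrs_clique (xv) (uv) _ => //; rewrite eq_sym.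
Qed.

End Walk.

(* [U] collects the cliques left behind by the earlier moves. Each of them
   carries a low vertex [z] whose neighbours in the other part are not closed
   under adjacency ([z'] and [u] witness it), so by [part_nbrs_closed] it
   never becomes part of a full clique again. *)
Lemma no_walk n P A a b x y (U : {set T}) :
  #|~: U| <= n -> a != b -> optimal P -> full_clique P a A ->
  x \in A -> y \in A -> low x -> low y ->
  part_nbrs P b x != part_nbrs P b y ->
  (forall w, w \in U -> w \notin A) ->
  (forall w, w \in U -> exists z z',
     [/\ z \in U, low z, P z = P w, z = w \/ e z w & e z z'] /\
     ([/\ z' = x, P w = b & forall u, u \in A -> u != x -> ~~ e z u] \/
      [/\ z' \in U, P w = b /\ P z' = a \/ P w = a /\ P z' = b &
        exists u, [/\ u \in U, P u = P z', e z' u & ~~ e z u]])) ->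
  False.
Proof.
elim: n P A a b x y U => [|n IH] P A a b x y U le_n ab optP fullA xA yA lx ly
  Nxy disU wit.
  move: le_n; rewrite leqn0 cards_eq0 => /eqP/setP/(_ x); rewrite !inE.
  by move/negbFE/disU; rewrite xA.
have [cA PA eA] := full_cliqueP _ _ _ fullA.
have [optQ fullQ] := move_low optP fullA yA ly ab.
set Q := move P y b in optQ fullQ; set A' := y |: part_nbrs P b y in fullQ.
have ba : b != a by rewrite eq_sym.
have xy : x != y by apply: contraNneq Nxy => ->.
have UA w : w \in U -> w != y by move=> wU; apply: contraTneq yA => <-; apply: disU.
have QU w : w \in U -> Q w = P w by move=> wU; rewrite /Q move_other ?UA.
have Qx : Q x = a by rewrite /Q move_other ?PA.
(* As [A] has at least four vertices, some neighbour [t] of [x] stays in part [a] with it when [y]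
   leaves. *)
have [t [tA tx ty]] : exists t, [/\ t \in A, t != x & t != y].
  by apply: card_gt2_other; rewrite cA leqW.
have Qt : Q t = a by rewrite /Q move_other ?PA.
have ext : e x t by apply: eA; rewrite // eq_sym.
(* The walk never returns to a clique left behind: otherwise the witness [z] would lie in [A'], and
   its neighbours in part [a] would be closed under adjacency there. *)
have disN w : w \in U -> w \notin part_nbrs P b y.
  move=> wU; apply/negP => wN.
  have Pw : P w = b by move: wN; rewrite inE => /andP[_ /eqP].
  have [z [z' [[zU lz Pz zw ezz'] wit']]] := wit w wU.
  have zA' : z \in A'.
    rewrite in_setU1; apply/orP; right; case: zw => [->//|ezw].
    by apply: (part_nbrs_closed optP fullA ab yA ly wN); rewrite ?Pz // eC.
  have closed u : Q z' = a -> e z' u -> Q u = a -> e z u.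
    move=> Qz' ez'u Qu.
    have z'N : z' \in part_nbrs Q a z by rewrite inE ezz' Qz' eqxx.
    have := part_nbrs_closed optQ fullQ ba zA' lz z'N ez'u Qu.
    by rewrite inE => /andP[].
  case: wit' => [[z'x _ nez]|[z'U [[_ Pz']|[Pw' _]] [u [uU Pu ez'u /negP[]]]]].
  - by have /negP[] := nez t tA tx; apply: closed; rewrite ?z'x.
  - by apply: closed; rewrite ?QU // Pu.
  - by move/eqP: ba; rewrite -Pw Pw'.
have lowN : exists2 w, w \in part_nbrs P b y & low w.
  apply: clique_low_exists.
    by move=> w1 w2; apply: (part_nbrs_clique optP fullA ab yA ly).
  by rewrite (card_part_nbrs optP fullA ab yA ly) ltnW.
have nex u : u \in part_nbrs P b y -> ~~ e x u.
  move=> uN; apply: contra Nxy => exu; apply/eqP.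
  apply: (part_nbrs_eq (x := u) optP fullA ab xA lx yA ly) => //.
  by move: uN; rewrite !inE exu => /andP[].
have [v vN lv] := lowN.
(* Next [y] and [v] play the roles of [x] and [y], with the parts swapped. Their neighbourhoods in
   part [a] differ at [x], which is also new in [U]. *)
apply: (IH Q A' b a y v (U :|: (A :\ y))) => //.
- rewrite -ltnS; apply: leq_trans le_n; apply: proper_card; apply/properP.
  split; first by rewrite setCS subsetUl.
  exists x; last by rewrite !inE xA xy orbT.
  by rewrite inE; apply: contraL xA; apply: disU.
- by rewrite setU11.
- by rewrite in_setU1 vN orbT.
- apply: contra (nex v vN) => /eqP/setP/(_ x).
  rewrite !inE Qx eqxx !andbT (eA y x yA xA); last by rewrite eq_sym.
  by rewrite eC => <-.
- move=> w; rewrite !in_setU in_set1 in_setD1 negb_or.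
  case/orP => [wU|/andP[wy wA]]; first by rewrite UA ?disN.
  rewrite wy inE PA // (negbTE ab) andbF //.
move=> w; rewrite in_setU => /orP[wU|].
  have [z [z' [[zU lz Pz zw ezz'] wit']]] := wit w wU.
  exists z, z'; split; first by split; rewrite ?in_setU ?zU // !QU.
  (* Once [x] is in [U], a witness of the first kind becomes one of the second kind, with [t] as the
     vertex not adjacent to [z]. *)
  right; case: wit' => [[z'x Pw nez]|[z'U Pwz' [u [uU Pu ez'u nezu]]]].
    rewrite z'x QU // Qx; split; [by rewrite !inE xA xy orbT|by right|].
    exists t; rewrite !inE tA ty orbT Qt; split=> //; exact: nez.
  rewrite !QU //; split; [by rewrite in_setU z'U|by case: Pwz'; [right|left]|].
  by exists u; rewrite in_setU uU QU.
(* For the clique just left, [x] is a witness of the first kind: it is adjacent to [y] but to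
   nothing else in [A']. *)
rewrite in_setD1 => /andP[wy wA]; exists x, y.
have Qw : Q w = a by rewrite /Q move_other ?PA.
split; first split=> //.
- by rewrite !inE xA xy orbT.
- by rewrite Qx Qw.
- by case: (eqVneq x w) => [->|xw]; [left|right; apply: eA].
- exact: eA.
left; split=> // u; rewrite in_setU1 => /predU1P[->|uN _]; first by rewrite eqxx.
exact: nex.
Qed.

Lemma part_nbrs_same P A a b x y : a != b -> optimal P -> full_clique P a A ->
  x \in A -> y \in A -> low x -> low y -> part_nbrs P b x = part_nbrs P b y.
Proof.
move=> ab optP fullA xA yA lx ly; apply/eqP; apply: contraT => Nxy.
by case: (@no_walk _ P A a b x y set0 (leqnn _)) => // w; rewrite inE.
Qed.

(** * Closed neighbourhoods of low vertices, and existence of full cliques *)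

Lemma optimal_closed_nbhd P i A : optimal P -> full_clique P i A ->
  exists v, let F := v |: [set w | e v w] in
  [/\ low v, forall w u, w \in F -> u \in F -> low w -> w != u -> e w u &
      #|F :\: [set w | low w]| <= m].
Proof.
move=> optP fullA; have [cA PA eA] := full_cliqueP _ _ _ fullA.
have [v vA lv] : exists2 v, v \in A & low v.
  by apply: clique_low_exists => //; rewrite cA; have := r_ge3 i; lia.
have Ni : part_nbrs P i v = A :\ v by apply: full_clique_nbrs fullA vA; case: optP.
have NP u : e v u -> u \in part_nbrs P (P u) v by rewrite inE eqxx => ->.
have NA u : e v u -> P u = i -> u \in A.
  by move=> /NP uN Pu; move: uN; rewrite Pu Ni inE => /andP[].
have clq u w : e v u -> e v w -> P u = P w -> u != w -> e u w.
  move=> evu evw Puw uw; have [Pu|Pu] := eqVneq i (P u).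
    by apply: eA => //; apply: NA; rewrite // -?Puw.
  apply: (part_nbrs_clique optP fullA Pu vA lv) => //; first exact: NP.
  by rewrite Puw; apply: NP.
exists v => /=; split=> //.
  move=> w u; rewrite !inE => /predU1P[->|evw] /predU1P[->|evu] lw wu //.
  - by rewrite eqxx in wu.
  - by rewrite eC.
  have [Pwu|Pwu] := eqVneq (P w) (P u); first exact: clq.
  suff : u \in part_nbrs P (P u) w by rewrite inE => /andP[].
  have [Pw|Pw] := eqVneq i (P w).
    have iu : i != P u by rewrite Pw.
    have wA : w \in A by apply: NA.
    by rewrite (part_nbrs_same iu optP fullA wA vA lw lv); apply: NP.
  (* With [v] moved into the part of [w], both are low vertices of one full clique, so they have the
     same neighbours in the part of [u]. *)
  have [optQ fullQ] := move_low optP fullA vA lv Pw.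
  have eqN := part_nbrs_same (x := w) (y := v) Pwu optQ fullQ.
  have {}eqN : part_nbrs (move P v (P w)) (P u) w
             = part_nbrs (move P v (P w)) (P u) v.
    by apply: eqN => //; rewrite in_setU1 ?eqxx // NP ?orbT.
  move/setP/(_ u): eqN.
  have uv : u != v by rewrite eq_sym (adj_neq eI).
  by rewrite !inE move_other // evu eqxx !andbT.
rewrite -[m in _ <= m]card_ord.
(* Neighbours of [v] in the same part are adjacent, whereas non-low vertices are not, so each part
   holds at most one of the latter. *)
have inj : {in (v |: [set w | e v w]) :\: [set w | low w] &, injective P}.
  move=> x y; rewrite !inE => /andP[lx xF] /andP[ly yF] Pxy.
  have xv : e v x by case/predU1P: xF lx => // ->; rewrite lv.
  have yv : e v y by case/predU1P: yF ly => // ->; rewrite lv.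
  apply/eqP; apply: contraT => xy; have := high_indep lx ly.
  by rewrite clq.
by rewrite -(card_in_imset inj) max_card.
Qed.

(** Without full cliques, [brooks] colours each part [i] with [r i] colours; disjoint palettes,
    encoded as tagged pairs, give [R] colours in all. *)
Lemma full_clique_exists P : potential_min P -> ~~ colorable_on e setT R ->
  exists i A, full_clique P i A.
Proof.
move=> minP ncol.
have [/existsP[i /existsP[A fullA]]|/existsPn none] :=
  boolP [exists i, exists A, full_clique P i A]; first by exists i, A.
case/negP: ncol.
have col i : exists f : T -> 'I_(r i), proper_on e f [set x | P x == i].
  apply: brooks => // [v|A sA cA cardA].
    rewrite inE => /eqP Pv; have := potential_min_degree v minP.
    rewrite Pv; apply: leq_trans; apply: subset_leq_card; apply/subsetP => w.
    by rewrite !inE andbC.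
  have /existsP[] := none i; exists A; apply/full_cliqueP; split=> // x xA.
  by have := subsetP sA x xA; rewrite inE => /eqP.
have [g pg] := fin_all_exists col.
apply: (@proper_colorable T e _ (fun x => Tagged (fun i => 'I_(r i)) (g (P x) x))).
  rewrite card_tagged sumnE big_map big_enum /=.
  by under eq_bigr do rewrite card_ord.
move=> x y _ _ exy; have [Pxy|Pxy] := eqVneq (P x) (P y).
  rewrite -Pxy eq_Tagged /=; apply: (pg (P x)); rewrite ?inE ?eqxx //.
  by rewrite Pxy eqxx.
by apply: contra Pxy => /eqP/(congr1 (@tag _ _))/= ->.
Qed.

End Partitions.

(** * Giving two non-low vertices a common colour *)

(* [h1] and [h2] together have fewer than [n] neighbours outside [L], hence can
   be given the same colour; each vertex of [L] then sees a repeated colour. *)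
Lemma colour_common_nbrs (T : finType) (e : rel T) n (L : {set T}) h1 h2 :
  symmetric e -> irreflexive e -> h1 != h2 -> ~~ e h1 h2 ->
  h1 \notin L -> h2 \notin L ->
  (forall v, v \in L -> [/\ deg e v <= n, e v h1 & e v h2]) ->
  deg e h1 + deg e h2 < n + 2 * #|L| ->
  colorable_on e (~: L) n -> colorable_on e setT n.
Proof.
move=> eC eI h12 neh h1L h2L Lh lt_n /colorable_onP[f pf].
have nbrsL h : (forall v, v \in L -> e v h) ->
    #|nbrs e (~: L) h| + #|L| = deg e h.
  move=> Lh'; rewrite /deg -(cardsID L [set w | e h w]) addnC.
  congr (_ + _); apply: eq_card => v.
    by rewrite !inE; case vL: (v \in L); rewrite ?andbF ?andbT // eC Lh'.
  by rewrite !inE.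
have d1 := nbrsL h1 (fun v vL => let: And3 _ a _ := Lh v vL in a).
have d2 := nbrsL h2 (fun v vL => let: And3 _ _ a := Lh v vL in a).
pose N := nbrs e (~: L) h1 :|: nbrs e (~: L) h2.
have [c cN] : exists c, c \notin f @: N.
  apply/existsP; apply: contraT => /existsPn allf.
  have : n <= #|f @: N|.
    rewrite -{1}[n]card_ord; apply/subset_leq_card/subsetP => c _.
    by move: (allf c); rewrite negbK.
  have := leq_imset_card f N; rewrite /N cardsU.
  by move: d1 d2 lt_n; lia.
pose g x := if x \in [set h1; h2] then c else f x.
have gh1 : g h1 = c by rewrite /g !inE eqxx.
have gh2 : g h2 = c by rewrite /g !inE eqxx orbT.
have pg : proper_on e g (~: L).
  have cf x y : x \in [set h1; h2] -> y \in ~: L -> e x y -> c != f y.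
    move=> xh yL exy; apply: contraNneq cN => ->; apply: imset_f.
    by move: xh exy; rewrite !inE in yL *; rewrite yL => /orP[]/eqP-> ->; rewrite ?orbT.
  move=> x y xL yL exy; rewrite /g; case: ifPn => xh; case: ifPn => yh.
  - move: xh yh exy; rewrite !inE => /orP[]/eqP-> /orP[]/eqP->;
      by rewrite ?eI ?(negbTE neh) // eC (negbTE neh).
  - exact: cf exy.
  - by rewrite eq_sym; apply: cf yh xL _; rewrite eC.
  - exact: pf.
suff ext (s : seq T) : {subset s <= L} -> exists2 g' : T -> 'I_n,
    proper_on e g' (~: L :|: [set x in s]) & g' h1 = g' h2.
  have [|g' pg' _] := ext (enum L); first by move=> x; rewrite mem_enum.
  apply/colorable_onP; exists g'; apply: proper_onS pg'.
  by apply/subsetP => x _; rewrite !inE mem_enum orNb.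
elim: s => [|x s IH] sL.
  exists g; last by rewrite gh1.
  by apply: proper_onS pg; apply/subsetP => x; rewrite !inE orbF.
have [|g' pg' gh] := IH; first by move=> y ys; apply: sL; rewrite inE ys orbT.
set D := ~: L :|: _ in pg'.
have subD : ~: L :|: [set y in x :: s] \subset x |: D.
  by apply/subsetP => y; rewrite !inE orbCA.
have [xD|xD] := boolP (x \in D).
  exists g' => //; apply: proper_onS pg'; apply: subset_trans subD _.
  by rewrite subUset sub1set xD subxx.
have [degx exh1 exh2] : [/\ deg e x <= n, e x h1 & e x h2].
  by apply: Lh; apply: sL; rewrite mem_head.
have h1D : h1 \in D by rewrite !inE h1L.
have h2D : h2 \in D by rewrite !inE h2L.
have lt_x : #|g' @: nbrs e D x| < n.
  have h1N : h1 \in nbrs e D x by rewrite inE h1D.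
  have h2N : h2 \in nbrs e D x by rewrite inE h2D.
  apply: leq_trans (card_colours_repeat h1N h2N h12 gh) _.
  apply: leq_trans degx; apply: subset_leq_card; apply/subsetP => y.
  by rewrite !inE => /andP[].
have [g2 pg2 g2E] := extend_one eC eI pg' xD lt_x.
exists g2; last by rewrite !g2E.
exact: proper_onS pg2.
Qed.

(** * Critical graphs whose high vertices are independent *)

Theorem theorem3p5 (k : nat) (T : finType) (e : rel T) :
  2 <= k ->
  simple_graph e ->
  vertex_critical e ->
  maxdeg e + 1 - k <= chi e ->
  6 * k <= maxdeg e + 1 ->
  H_edgeless e ->
  is_complete_graph e (chi e).
Proof.
move=> k2 [eC eI] crit chi_ge Delta_ge Hedge.
set c := chi e in chi_ge *.
have c5k : 5 * k <= c by lia.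
have colc (S : {set T}) v : v \notin S -> colorable_on e S c.-1.
  move=> vS; apply: (colorable_onW (S2 := setT :\ v) (n1 := chi_on e (setT :\ v))).
  - by apply/subsetP => x xS; rewrite !inE andbT; apply: contraNneq vS => <-.
  - by have := crit v; rewrite -/c; lia.
  - exact: colorable_chi_on.
have ncol : ~~ colorable_on e setT c.-1.
  by apply/negP => /chi_on_le; rewrite -/(chi e) -/c; lia.
have deg_lt v : deg e v < c + k.
  by have : deg e v <= maxdeg e := leq_bigmax v; lia.
(* With fewer neighbours, [v] could be added to a colouring of the other vertices with [c.-1]
   colours. *)
have deg_ge v : c.-1 <= deg e v.
  rewrite leqNgt; apply: contra ncol => lt_d.
  have vS : v \notin setT :\ v by rewrite !inE eqxx.
  have /colorable_onP[f pf] := colc _ _ vS.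
  have [|g pg _] := extend_one eC eI pf vS.
    apply: card_colours_lt; apply: leq_ltn_trans lt_d; apply: subset_leq_card.
    by apply/subsetP => w; rewrite !inE => /andP[].
  by apply/colorable_onP; exists g; apply: proper_onS pg; rewrite setD1K ?inE.
(* The first value is at least [2 * k - 1 >= 3], as [5 * k <= c] and [2 <= k]. With [k.+1] parts the
   sum of the [(r i).+1] is [c + k], which exceeds all degrees. *)
pose r (i : 'I_k.+1) := if i == ord0 then c.-1 - 3 * k else 3.
have sum_r : \sum_i r i = c.-1.
  rewrite big_ord_recl /r /= (eq_bigr (fun=> 3)) // sum_nat_const card_ord.
  by lia.
have r3 i : 2 < r i by rewrite /r; case: ifP => _; lia.
have dbound v : deg e v < \sum_i (r i).+1.
  rewrite (eq_bigr (fun i => 1 + r i)) // big_split /= sum_r sum_nat_const card_ord.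
  by have := deg_lt v; lia.
have hindep x y : deg e x != \sum_i r i -> deg e y != \sum_i r i -> ~~ e x y.
  rewrite sum_r => hx hy; apply: Hedge; rewrite inE -/c;
    [have := deg_ge x|have := deg_ge y]; lia.
have [P optP] := optimal_exists e r ord0.
have [|i [A fullA]] := full_clique_exists eC eI dbound r3 (proj1 optP).
  by rewrite sum_r.
have [v] := optimal_closed_nbhd eC eI dbound r3 hindep optP fullA.
set F := v |: _ => /= -[lv Fadj Fhigh].
pose L := F :&: [set w | low e r w].
have lowE w : low e r w = (deg e w == c.-1) by rewrite /low sum_r.
have cF : #|F| = c.
  rewrite cardsU1 inE eI /= -/(deg e v).
  by move: lv; rewrite lowE => /eqP->; lia.
have cL : c <= #|L| + k.+1 by rewrite -cF -(cardsID [set w | low e r w] F) leq_add2l.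
have [/card_gt1P[h1 [h2 []]]|le1] := ltnP 1 #|F :\: [set w | low e r w]|.
  rewrite !in_setD => /andP[+ F1] /andP[+ F2] h12.
  rewrite !inE => l1 l2; case/negP: ncol.
  have vL : v \notin ~: L by rewrite !inE eqxx lv.
  apply: (colour_common_nbrs (L := L) eC eI h12) (colc _ _ vL).
  - by apply: hindep; [move: l1|move: l2].
  - by rewrite !inE (negbTE l1) andbF.
  - by rewrite !inE (negbTE l2) andbF.
  - move=> w; rewrite in_setI inE => /andP[wF lw]; split.
    + by move: lw; rewrite lowE => /eqP->.
    + by apply: Fadj => //; apply: contraNneq l1 => <-.
    + by apply: Fadj => //; apply: contraNneq l2 => <-.
  (* Both degrees are at most [c + k - 1] and [#|L| >= c - k - 1], so [4 * k + 1 < c] suffices; it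
     follows from [5 * k <= c] and [2 <= k]. *)
  - by have := deg_lt h1; have := deg_lt h2; lia.
have Fclique x y : x \in F -> y \in F -> x != y -> e x y.
  move=> xF yF xy; have [lx|hx] := boolP (low e r x); first exact: Fadj.
  have [ly|hy] := boolP (low e r y); first by rewrite eC Fadj // eq_sym.
  suff : 1 < #|F :\: [set w | low e r w]| by rewrite ltnNge le1.
  by apply/card_gt1P; exists x, y; rewrite !in_setD xF yF !andbT !inE.
have FT x : x \in F.
  (* If [x] were outside [F], criticality would colour the clique [F] of size [c] with [c.-1]
     colours. *)
  apply: contraT => /colc /colorable_onP[f pf].
  have inj : {in F &, injective f}.
    move=> y z yF zF fyz; apply/eqP; apply: contraT => yz.
    by have := pf y z yF zF (Fclique y z yF zF yz); rewrite fyz eqxx.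
  have := max_card (mem (f @: F)).
  by rewrite (card_in_imset inj) card_ord cF; lia.
split; last by move=> x y; apply: Fclique.
by rewrite -cF; apply: eq_card => x; rewrite FT.
Qed.
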